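(* Let $(\tau_i)_{i\in I}$ be a $*$-transversal family of mappings $\tau_i:D\to U$ (where $D\subseteq U$). Then $$\mathcal D:=\Big\{\bigoplus\nolimits_{i\in I}K(u^{\tau_i},b_i)\ \Big|\ u\in D\Big\}\cup\{W\}$$ is a dual spread of $\mathbb P(K,V)$. Conversely, each dual spread of $\mathbb P(K,V)$ containing $W$ can be obtained in this way.
   Context: $K$ is a not necessarily commutative field (division ring), $U\neq\{0\}$ is a left $K$-vector space of arbitrary (possibly infinite) dimension with a fixed basis $(b_i)_{i\in I}$, $V=U\times U$ and $W=U\times\{0\}$. $\mathbb P(K,V)$ is the projective space of subspaces of $V$. Maps are written as exponents on the right. A dual spread of $\mathbb P(K,V)$ is a set of pairwise complementary subspaces of $V$ such that each hyperplane of $V$ contains one of its elements. A family $(\tau_i)_{i\in I}$ (indexed by the same set $I$ as the basis) of mappings $\tau_i:D\to U$, where $D\subseteq U$, is called $*$-transversal if the following two conditions hold: (T1* ) Given distinct $u,u'\in D$, the family $(u^{\tau_i}-u'^{\tau_i})_{i\in I}$ is a basis of $U$. (T2* ) Given a family $(c_i)_{i\in I}\in U^I$ and a hyperplane $H$ of $U$, there is a $u\in D$ such that $(u^{\tau_i})_{i\in I}\in(c_i)_{i\in I}+H^I$. Here $U^I$ and $H^I$ denote the sets of all $I$-indexed families in $U$ and in $H$, respectively. *)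

(* Defs.v *)
From HB Require Import structures.
From mathcomp Require Import all_boot all_order all_algebra.
From mathcomp Require Import boolp classical_sets.

Set Implicit Arguments.
Unset Strict Implicit.
Unset Printing Implicit Defensive.

Import GRing.Theory.
Local Open Scope classical_set_scope.
Local Open Scope ring_scope.

(* MathComp has no bundled structure of division rings: K is a unitRingType in
   which every nonzero element is a unit, with no commutativity assumption. *)
Definition division_ring (K : unitRingType) : Prop := GRing.field_axiom K.

Section Families.
Context {K : unitRingType} {V : lmodType K} {I : eqType}.
Implicit Types (e : I -> V) (F : I -> set V).

Definition lin_indep e : Prop :=
  forall (s : seq I) (a : I -> K), uniq s ->
    \sum_(i <- s) a i *: e i = 0 -> {in s, forall i, a i = 0}.

Definition generates e : Prop :=
  forall x : V, exists (s : seq I) (a : I -> K),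
    uniq s /\ x = \sum_(i <- s) a i *: e i.

Definition is_basis e : Prop := lin_indep e /\ generates e.

Definition direct F : Prop :=
  forall (s : seq I) (x : I -> V), uniq s -> (forall i, F i (x i)) ->
    \sum_(i <- s) x i = 0 -> {in s, forall i, x i = 0}.

(* The sum of the subspaces F i. It is direct in every use made of it here;
   see direct_lines below. *)
Definition dsum F : set V :=
  [set v | exists (s : seq I) (x : I -> V),
    [/\ uniq s, forall i, F i (x i) & v = \sum_(i <- s) x i]].

End Families.

Section Subspaces.
Context {K : unitRingType} {V : lmodType K}.
Implicit Types (X Y H : set V) (S : set (set V)).

Definition subspace X : Prop := GRing.submod_closed (mem X).

Definition line (v : V) : set V := range (fun a : K => a *: v).

Definition complementary X Y : Prop :=
  X `&` Y = [set 0] /\ [set x + y | x in X & y in Y] = [set: V].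

(* Hyperplanes are the maximal proper subspaces. *)
Definition hyperplane H : Prop :=
  [/\ subspace H, H <> [set: V] &
      forall X, subspace X -> H `<=` X -> X = H \/ X = [set: V]].

Definition dual_spread S : Prop :=
  [/\ forall X, S X -> subspace X,
      forall X Y, S X -> S Y -> X <> Y -> complementary X Y &
      forall H, hyperplane H -> exists2 X, S X & X `<=` H].

End Subspaces.

Definition W_of (K : unitRingType) (U : lmodType K) : set (U * U)%type :=
  [set: U] `*` [set 0].
Arguments W_of {K} U _.

Section Transversal.
Context {K : unitRingType} {U : lmodType K} {I : eqType}.

Definition star_transversal (D : set U) (tau : I -> D -> U) : Prop :=
  (forall u u' : D, u <> u' -> is_basis (fun i => tau i u - tau i u')) /\
  (forall (c : I -> U) (H : set U), hyperplane H ->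
     exists (u : D) (h : I -> U),
       (forall i, H (h i)) /\ (forall i, tau i u = c i + h i)).

Definition spread_of (b : I -> U) (D : set U) (tau : I -> D -> U) :
    set (set (U * U)%type) :=
  [set dsum (fun i => line (tau i u, b i)) | u in [set: D]] `|` [set W_of U].

Lemma direct_lines (b t : I -> U) :
  lin_indep b -> direct (fun i => line (t i, b i)).
Proof.
move=> fb s x us xP sum0 i si.
have /choice[a aP] : forall j, exists c : K, c *: (t j, b j) = x j.
  by move=> j; have [c _ <-] := xP j; exists c.
have : \sum_(j <- s) a j *: b j = 0.
  rewrite -[RHS]/((0 : U * U).2) -sum0 raddf_sum.
  by apply: eq_bigr => j _; rewrite -aP.
by move=> /(fb s a us)/(_ i si) ai0; rewrite -aP ai0 scale0r.
Qed.

End Transversal.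

(* Main.v *)
Require Import Defs.
From mathcomp Require Import all_boot all_order all_algebra.
From mathcomp Require Import boolp classical_sets.

(** Write W for U x 0. A subspace of V = U x U is complementary to W exactly
    when it is the graph {(f q, q)} of a linear map f : U -> U, and f is the
    same thing as the family t of its values t i = f (b i) on the basis
    ([graph_complement], [complement_surj], [complement_eq_graph]). So a set of
    pairwise complementary subspaces containing W is W together with a set of
    graphs, and the two transversality conditions are the two conditions of a
    dual spread, read through this dictionary.

    - The graphs of f and f' are complementary iff f - f' is bijective, that is,
      iff it sends the basis b to a basis ([complementary_graphs]). This is the
      first transversality condition.
    - A hyperplane of V that does not contain W meets W in H x 0 for a
      hyperplane H of U, and it contains a point (c i, b i) above each basis
      vector ([hyperplane_trace], [hyperplane_add_proj]). Conversely every
      family c and every hyperplane H of U arise in this way, from the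
      hyperplane spanned by the graph of c and H x 0 ([hyperplane_lift]). A
      graph lies in this hyperplane iff its values t i belong to c i + H. This
      is the second transversality condition; the hyperplanes containing W are
      taken care of by W itself.

    It remains to index the graphs in a given dual spread by a subset D of U.
    Linear maps with pairwise bijective differences take pairwise distinct
    values at any single basis vector b i0, so the values t i0 can serve as
    indices. *)

Local Open Scope classical_set_scope.
Local Open Scope ring_scope.

Set Implicit Arguments.
Unset Strict Implicit.
Unset Printing Implicit Defensive.

Import GRing.Theory.

(** * Subspaces and sums of subspaces *)

Section SubspaceTheory.
Context {K : unitRingType} {V : lmodType K}.
Implicit Types (X Y : set V).

Lemma subspaceP X :
  subspace X <-> X 0 /\ forall a x y, X x -> X y -> X (a *: x + y).
Proof.
split=> [[X0 XD]|[X0 XD]].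
  split=> [|a x y Xx Xy]; first by rewrite -in_setE.
  by rewrite -in_setE; apply: XD; rewrite in_setE.
split=> [|a x y]; first by change (0 \in X); rewrite in_setE.
change (x \in X -> y \in X -> a *: x + y \in X).
by rewrite !in_setE; apply: XD.
Qed.

Lemma subspace0 X : subspace X -> X 0.
Proof. by case/subspaceP. Qed.

Lemma subspaceD X x y : subspace X -> X x -> X y -> X (x + y).
Proof. by case/subspaceP=> _ XD Xx Xy; rewrite -[x]scale1r; apply: XD. Qed.

Lemma subspaceZ X a x : subspace X -> X x -> X (a *: x).
Proof. by case/subspaceP=> X0 XD Xx; rewrite -[_ *: _]addr0; apply: XD. Qed.

Lemma subspaceB X x y : subspace X -> X x -> X y -> X (x - y).
Proof.
by move=> sX Xx Xy; apply: subspaceD => //; rewrite -scaleN1r; apply: subspaceZ.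
Qed.

Lemma subspace_sum (J : Type) (s : seq J) (x : J -> V) X :
  subspace X -> (forall j, X (x j)) -> X (\sum_(j <- s) x j).
Proof.
move=> sX Xx; elim/big_ind: _ => //; first exact: subspace0.
by move=> y z; apply: subspaceD.
Qed.

Lemma subspace_add X Y : subspace X -> subspace Y ->
  subspace [set x + y | x in X & y in Y].
Proof.
move=> sX sY; apply/subspaceP; split.
  by exists 0; [exact: subspace0 | exists 0; [exact: subspace0 | rewrite addr0]].
move=> a _ _ [x Xx [y Yy <-]] [x' Xx' [y' Yy' <-]].
exists (a *: x + x'); first by apply: subspaceD => //; apply: subspaceZ.
exists (a *: y + y'); first by apply: subspaceD => //; apply: subspaceZ.
by rewrite scalerDr addrACA.
Qed.

Lemma subspace_line (v : V) : subspace (line v).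
Proof.
apply/subspaceP; split; first by exists 0; rewrite ?scale0r.
by move=> a _ _ [c _ <-] [d _ <-]; exists (a * c + d); rewrite // scalerDl scalerA.
Qed.

Lemma complementary_sym X Y : complementary X Y -> complementary Y X.
Proof.
case=> XY0 XYT; split; first by rewrite setIC.
rewrite -XYT; apply/seteqP; split=> _ [x Xx [y Yy <-]];
  by exists y => //; exists x; rewrite // addrC.
Qed.

Lemma complementary_eq0 X Y v : complementary X Y -> X v -> Y v -> v = 0.
Proof. by case=> XY0 _ Xv Yv; have : (X `&` Y) v by []; rewrite XY0. Qed.

Lemma complementary_split X Y v : complementary X Y ->
  exists2 x, X x & Y (v - x).
Proof.
case=> _ XYT; have : [set: V] v by [].
by rewrite -XYT => -[x Xx [y Yy <-]]; exists x => //; rewrite addrC addKr.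
Qed.

Lemma complementaryI X Y : subspace X -> subspace Y ->
  (forall v, X v -> Y v -> v = 0) ->
  (forall v, exists2 x, X x & Y (v - x)) -> complementary X Y.
Proof.
move=> sX sY XY0 XYT; split; apply/seteqP; split=> v.
- by case=> Xv Yv; exact: XY0.
- by move=> ->; split; exact: subspace0.
- by [].
- move=> _; have [x Xx Yvx] := XYT v.
  by exists x => //; exists (v - x); rewrite // addrC subrK.
Qed.

Context {I : eqType}.

(** Two finite supports are merged by extending both families by zero. *)
Lemma subspace_dsum (F : I -> set V) :
  (forall i, subspace (F i)) -> subspace (dsum F).
Proof.
move=> sF.
have extend (s r : seq I) (x : I -> V) : uniq s -> uniq r -> {subset s <= r} ->
    \sum_(i <- s) x i = \sum_(i <- r) (if i \in s then x i else 0).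
  move=> us ur sr; rewrite -big_mkcond -[RHS]big_filter.
  apply/perm_big/uniq_perm => //; first exact: filter_uniq.
  by move=> i; rewrite mem_filter; case si: (i \in s); rewrite // sr.
apply/subspaceP; split.
  exists [::], (fun=> 0); split=> //; first by move=> i; exact: subspace0.
  by rewrite big_nil.
move=> a _ _ [s [x [us Fx ->]]] [r [y [ur Fy ->]]].
pose w := undup (s ++ r).
exists w, (fun i => a *: (if i \in s then x i else 0)
                    + (if i \in r then y i else 0)).
split; first exact: undup_uniq.
  by move=> i; apply: subspaceD => //; first apply: subspaceZ => //;
    case: ifP => _ //; exact: subspace0.
rewrite big_split -scaler_sumr /=.
rewrite -(extend s) ?undup_uniq// -1?(extend r) ?undup_uniq//.
- by move=> i si; rewrite mem_undup mem_cat si orbT.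
- by move=> i si; rewrite mem_undup mem_cat si.
Qed.

Lemma dsum_sub (F : I -> set V) X :
  subspace X -> (forall i, F i `<=` X) -> dsum F `<=` X.
Proof.
by move=> sX FX _ [s [x [_ Fx ->]]]; apply: subspace_sum => // j; exact: FX.
Qed.

Lemma sub_dsum (F : I -> set V) i :
  (forall j, subspace (F j)) -> F i `<=` dsum F.
Proof.
move=> sF v Fv; exists [:: i], (fun j => if j == i then v else 0).
split=> // [j|]; last by rewrite big_seq1 eqxx.
by case: eqP => [->//|_]; exact: subspace0.
Qed.

End SubspaceTheory.

(** * Complements of W as graphs of linear maps *)

Section Graphs.
Context {K : unitRingType} {U : lmodType K}.
Implicit Types (X : set (U * U)%type).

Lemma subspace_W : subspace (W_of U).
Proof.
apply/subspaceP; split=> // a [x1 x2] [y1 y2] [_ /= ->] [_ /= ->].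
by split=> //=; rewrite scaler0 addr0.
Qed.

Lemma in_W (p : U) : W_of U (p, 0). Proof. by []. Qed.

Lemma complement_inj X p p' q : subspace X -> complementary (W_of U) X ->
  X (p, q) -> X (p', q) -> p = p'.
Proof.
move=> sX cX Xp Xp'; have := subspaceB sX Xp Xp'.
have -> : (p, q) - (p', q) = (p - p', 0) by congr pair; rewrite /= subrr.
move=> Xd; have [/eqP] := complementary_eq0 cX (in_W _) Xd.
by rewrite subr_eq0 => /eqP.
Qed.

(** With [complement_inj]: each q has exactly one point of X above it, so X is
    the graph of a map from the second coordinate to the first. *)
Lemma complement_surj X q : complementary (W_of U) X -> exists p, X (p, q).
Proof.
move=> /(complementary_split (0, q))[[w1 w2] [_ /= ->] Xw].
by exists (- w1); move: Xw; congr X; congr pair; rewrite /= ?sub0r ?subr0.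
Qed.

Context {I : eqType} (b : I -> U).
Hypothesis hb : is_basis b.

(** The graph of the linear map b i |-> t i, the second coordinate being the
    argument of the map. *)
Definition graph (t : I -> U) : set (U * U)%type :=
  dsum (fun i => line (t i, b i)).

Lemma subspace_graph t : subspace (graph t).
Proof. by apply: subspace_dsum => i; exact: subspace_line. Qed.

Lemma graph_basis t i : graph t (t i, b i).
Proof.
apply: (@sub_dsum _ _ _ _ i) => [j|]; first exact: subspace_line.
by exists 1; rewrite ?scale1r.
Qed.

Lemma graph_sub t X : subspace X -> (forall i, X (t i, b i)) -> graph t `<=` X.
Proof.
by move=> sX Xt; apply: dsum_sub => // i _ [a _ <-]; exact: subspaceZ.
Qed.

Lemma subspace_comb X (t : I -> U) (s : seq I) (a : I -> K) :
  subspace X -> (forall i, X (t i, b i)) ->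
  X (\sum_(i <- s) a i *: t i, \sum_(i <- s) a i *: b i).
Proof.
move=> sX Xt; have := @subspace_sum _ _ _ s (fun i => a i *: (t i, b i)) X sX.
move=> /(_ (fun i => subspaceZ _ sX (Xt i))); congr X.
by rewrite [LHS]surjective_pairing !raddf_sum.
Qed.

(** Trivial intersection with W is the linear independence of b, and W together
    with the graph is everything because b generates U. *)
Lemma graph_complement t : complementary (W_of U) (graph t).
Proof.
apply: complementaryI; [exact: subspace_W | exact: subspace_graph | |].
  move=> [v1 v2] [_ /= ->] [s [x [us xP vE]]].
  rewrite vE big_seq big1 // => i si.
  apply: (direct_lines hb.1 us xP _ si).
  have /choice[a aP] j : exists c : K, c *: (t j, b j) = x j.
    by have [c _ <-] := xP j; exists c.
  have a0 : \sum_(j <- s) a j *: b j = 0.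
    rewrite -[RHS]/((v1, 0 : U).2) vE raddf_sum.
    by apply: eq_bigr => j _; rewrite -aP.
  rewrite big_seq big1 // => j sj.
  by rewrite -aP (hb.1 _ _ us a0 _ sj) scale0r.
move=> [p q]; have [s [a [_ qE]]] := hb.2 q.
exists (p - \sum_(i <- s) a i *: t i, 0); first exact: in_W.
have -> : (p, q) - (p - \sum_(i <- s) a i *: t i, 0)
    = (\sum_(i <- s) a i *: t i, \sum_(i <- s) a i *: b i).
  by congr pair; rewrite /= ?subKr // subr0.
by apply: subspace_comb; [exact: subspace_graph | exact: graph_basis].
Qed.

(** X contains the graph since it contains its generators; nothing is left over
    because the graph already has a point above each second coordinate, and X
    has no two of them. *)
Lemma complement_eq_graph X t : subspace X -> complementary (W_of U) X ->
  (forall i, X (t i, b i)) -> X = graph t.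
Proof.
move=> sX cX Xt; apply/seteqP; split; last exact: graph_sub.
move=> [p q] Xpq; have [p' gp'] := complement_surj q (graph_complement t).
by rewrite (complement_inj sX cX Xpq (graph_sub sX Xt gp')).
Qed.

(** If f and f' are the linear maps with these graphs, a common point (p, q)
    satisfies (f - f') q = 0, and writing (p, q) as a sum of points above x and
    q - x amounts to solving (f - f') x = p - f' q. So both sides say that
    f - f' is bijective. *)
Lemma complementary_graphs t t' :
  complementary (graph t) (graph t') <-> is_basis (fun i => t i - t' i).
Proof.
have gcomb r s a : graph r (\sum_(i <- s) a i *: r i, \sum_(i <- s) a i *: b i).
  by apply: subspace_comb; [exact: subspace_graph | exact: graph_basis].
have sumB s (a : I -> K) : \sum_(i <- s) a i *: (t i - t' i)
    = \sum_(i <- s) a i *: t i - \sum_(i <- s) a i *: t' i.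
  by rewrite -sumrB; apply: eq_bigr => i _; rewrite scalerBr.
(* A point of a graph is the combination of generators that its second
   coordinate prescribes. *)
have graphE r s a p : graph r (p, \sum_(i <- s) a i *: b i) ->
    p = \sum_(i <- s) a i *: r i.
  move=> gp; apply: (complement_inj _ (graph_complement r) gp) => //.
  exact: subspace_graph.
split=> [c|[free gen]].
  split=> [s a us|p].
    rewrite sumB => /eqP; rewrite subr_eq0 => /eqP E; apply: hb.1 => //.
    have := gcomb t' s a; rewrite -E => g'.
    by have [] := complementary_eq0 c (gcomb t s a) g'.
  (* The summands of (p, 0) lie above q and - q, so p is the value of the
     difference of the two maps at q. *)
  have [[x q] gx] := complementary_split (p, 0) c.
  have [s [a [us qE]]] := hb.2 q.
  have -> : (p, 0) - (x, q) = (p - x, \sum_(i <- s) (- a i) *: b i).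
    congr pair; rewrite /= sub0r qE -sumrN.
    by apply: eq_bigr => i _; rewrite scaleNr.
  rewrite qE in gx; move=> /graphE pxE; exists s, a; split=> //.
  rewrite sumB -(graphE _ _ _ _ gx).
  have : p - x = - \sum_(i <- s) a i *: t' i.
    by rewrite pxE -sumrN; apply: eq_bigr => i _; rewrite scaleNr.
  by move=> <-; rewrite addrC subrK.
apply: complementaryI; [exact: subspace_graph | exact: subspace_graph | |].
  move=> [p q]; have [s [a [us ->]]] := hb.2 q => /graphE-> /graphE E.
  have /free a0 : \sum_(i <- s) a i *: (t i - t' i) = 0.
    by rewrite sumB E subrr.
  by congr pair; rewrite /= big_seq big1 // => i si; rewrite a0 // scale0r.
move=> [p q]; have [y gy] := complement_surj q (graph_complement t').
have [s [a [us E]]] := gen (p - y).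
exists (\sum_(i <- s) a i *: t i, \sum_(i <- s) a i *: b i); first exact: gcomb.
have -> : (p, q) - (\sum_(i <- s) a i *: t i, \sum_(i <- s) a i *: b i)
    = (y, q) - (\sum_(i <- s) a i *: t' i, \sum_(i <- s) a i *: b i).
  congr pair; rewrite /= -[p](subrK y) E sumB.
  by rewrite addrAC [X in X + y]addrAC subrr add0r addrC.
by apply: subspaceB (gcomb _ _ _) => //; exact: subspace_graph.
Qed.

End Graphs.

(** * Hyperplanes of U and of V not containing W *)

Section Hyperplanes.
Context {K : unitRingType} {U : lmodType K}.

Lemma subspace_trace (Y : set (U * U)%type) :
  subspace Y -> subspace [set p | Y (p, 0)].
Proof.
move=> sY; apply/subspaceP; split; first exact: (subspace0 sY).
move=> a x y Yx Yy; have := subspaceD sY (subspaceZ a sY Yx) Yy.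
by congr Y; congr pair; rewrite /= scaler0 addr0.
Qed.

Lemma subspace_lift (X : set U) :
  subspace X -> subspace [set (p, 0 : U) | p in X].
Proof.
move=> sX; apply/subspaceP; split; first by exists 0 => //; exact: subspace0.
move=> a _ _ [x Xx <-] [y Xy <-]; exists (a *: x + y).
  by apply: subspaceD => //; exact: subspaceZ.
by congr pair; rewrite /= scaler0 addr0.
Qed.

(** By maximality H + W is the whole space. *)
Lemma hyperplane_add_proj (H : set (U * U)%type) q :
  hyperplane H -> ~ W_of U `<=` H -> exists p, H (p, q).
Proof.
case=> sH _ maxH nWH.
have sHW := subspace_add sH (@subspace_W K U).
case: (maxH _ sHW) => [v Hv|E|E].
- by exists v => //; exists 0; rewrite ?addr0.
- case: nWH => w Ww; rewrite -E; exists 0; first exact: subspace0.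
  by exists w; rewrite ?add0r.
have : [set: (U * U)%type] (0, q) by [].
rewrite -E => -[[h1 h2] Hh [[w1 w2] [_ /= ->]]] [_ E2].
by exists h1; rewrite -E2 addr0.
Qed.

(** A subspace X strictly between the trace and U would give H + (X x 0)
    strictly between H and V. *)
Lemma hyperplane_trace (H : set (U * U)%type) :
  hyperplane H -> ~ W_of U `<=` H -> hyperplane [set p | H (p, 0)].
Proof.
case=> sH _ maxH nWH; split; first exact: subspace_trace.
  move=> E; apply: nWH => -[p q] [_ /= ->].
  by have : [set: U] p by []; rewrite -E.
move=> X sX HX.
case: (maxH _ (subspace_add sH (subspace_lift sX))) => [v Hv|E|E].
- exists v => //; exists 0; last by rewrite addr0.
  by exists 0 => //; exact: subspace0.
- left; apply/seteqP; split=> // p Xp /=; rewrite -E.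
  exists 0; first exact: subspace0.
  by exists (p, 0); [exists p | rewrite add0r].
right; apply/seteqP; split=> // p _.
have : [set: (U * U)%type] (p, 0) by [].
rewrite -E => -[[h1 h2] Hh [_ [x Xx <-] [<-]]].
rewrite /= addr0 => h20; rewrite h20 in Hh.
by apply: subspaceD => //; exact: HX.
Qed.

(** Since V / X is isomorphic to W, hence to U, the subspaces of V containing X
    correspond to the subspaces of U by taking traces, and L is the one whose
    trace is H. *)
Lemma hyperplane_lift (X : set (U * U)%type) (H : set U) :
  subspace X -> complementary (W_of U) X -> hyperplane H ->
  let L := [set x + w | x in X & w in [set (p, 0 : U) | p in H]] in
  hyperplane L /\ ~ W_of U `<=` L.
Proof.
move=> sX cX [sH HT maxH] L.
have XL : X `<=` L.
  move=> x Xx; exists x => //; exists 0; last by rewrite addr0.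
  by exists 0 => //; exact: subspace0.
have nWL : ~ W_of U `<=` L.
  move=> WL; apply: HT; apply/seteqP; split=> // p _.
  have [[x1 x2] Xx [_ [h Hh <-] [<-]]] := WL _ (in_W p).
  rewrite /= addr0 => x20; rewrite x20 in Xx.
  by have [->] := complementary_eq0 cX (in_W _) Xx; rewrite add0r.
have sL : subspace L by apply: subspace_add => //; exact: subspace_lift.
split=> //; split=> // [LT|Y sY LY]; first by apply: nWL; rewrite LT.
have YX v : exists x p, [/\ v = (p, 0) + x, X x & Y v -> Y (p, 0)].
  have [[w1 w2] [_ /= ->] Xvw] := complementary_split v cX.
  exists (v - (w1, 0)), w1; split=> //; first by rewrite addrC subrK.
  by move=> Yv; have := subspaceB sY Yv (LY _ (XL _ Xvw)); rewrite subKr.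
case: (maxH _ (subspace_trace sY)) => [h Hh|E|E].
- apply: LY; exists 0; first exact: subspace0.
  by exists (h, 0); [exists h | rewrite add0r].
- left; apply/seteqP; split=> // v Yv.
  have [x [p [vE Xx /(_ Yv)Yp]]] := YX v; rewrite vE.
  exists x => //; exists (p, 0); last by rewrite addrC.
  by exists p => //; rewrite -E.
right; apply/seteqP; split=> // v _.
have [x [p [-> Xx _]]] := YX v.
apply: subspaceD => //; last exact: LY (XL _ Xx).
by have : [set: U] p by []; rewrite -E.
Qed.

End Hyperplanes.

(** * The correspondence *)

Section Correspondence.
Context {K : unitRingType} {U : lmodType K} {I : eqType} (b : I -> U).
Hypothesis hb : is_basis b.

Lemma spread_of_dual_spread (D : set U) (tau : I -> D -> U) :
  star_transversal tau -> dual_spread (spread_of b tau).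
Proof.
move=> [T1 T2]; split.
- move=> X [[u _ <-]|->]; [exact: subspace_graph | exact: subspace_W].
- move=> X Y [[u _ <-]|->] [[u' _ <-]|->] neq //.
  + by apply/(complementary_graphs hb)/T1 => uu'; apply: neq; rewrite uu'.
  + exact/complementary_sym/graph_complement.
  + exact: graph_complement.
move=> H hH; case: (pselect (W_of U `<=` H)) => [WH|nWH].
  by exists (W_of U) => //; right.
have /choice[c Hc] i := hyperplane_add_proj (b i) hH nWH.
have [u [h [Hh tauE]]] := T2 c _ (hyperplane_trace hH nWH).
exists (graph b (tau ^~ u)); first by left; exists u.
have sH : subspace H by case: hH.
apply: graph_sub => // i; rewrite tauE; have := subspaceD sH (Hc i) (Hh i).
by congr H; congr pair; rewrite /= addr0.
Qed.

(** The index i0 selects the basis vector at which the linear maps are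
    evaluated in order to label the members of S other than W by vectors. *)
Lemma dual_spread_spread_of (S : set (set (U * U)%type)) (i0 : I) :
  dual_spread S -> S (W_of U) ->
  exists (D : set U) (tau : I -> D -> U),
    star_transversal tau /\ S = spread_of b tau.
Proof.
case=> sub comp hyp SW.
pose S' := [set X | S X /\ X <> W_of U].
have cW X : S' X -> complementary (W_of U) X.
  by case=> SX XW; apply: comp => // /esym.
have /choice[t tP] X : exists t : I -> U, S' X -> forall i, X (t i, b i).
  case: (pselect (S' X)) => [S'X|nS']; last by exists (fun=> 0).
  by have /choice[t tP] i := complement_surj (b i) (cW _ S'X); exists t.
have b0 : b i0 <> 0.
  move=> b00; have := hb.1 [:: i0] (fun=> 1) isT.
  rewrite big_seq1 b00 scaler0 => /(_ erefl i0); rewrite mem_head => /(_ isT).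
  by move/eqP; rewrite oner_eq0.
(* Distinct members of S other than W have different values at the basis vector
   b i0: with the same value there, the two graphs would meet outside 0. *)
have t_inj X Y : S' X -> S' Y -> t X i0 = t Y i0 -> X = Y.
  move=> SX SY E; case: (pselect (X = Y)) => // XY; case: b0.
  have c := comp _ _ SX.1 SY.1 XY.
  have := tP Y SY i0; rewrite -E => Yt.
  by have [] := complementary_eq0 c (tP X SX i0) Yt.
pose D := [set t X i0 | X in S'].
have /choice[g gP] (u : D) : exists X, S' X /\ t X i0 = val u.
  by have := valP u; rewrite in_setE => -[X SX <-]; exists X.
have gE u : g u = graph b (t (g u)).
  have [Sg _] := gP u; apply: complement_eq_graph => //.
  - exact: (sub _ Sg.1).
  - exact: cW.
  - exact: tP.
have gK X : S' X -> exists u, g u = X.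
  move=> SX; have DX : t X i0 \in D by rewrite in_setE; exists X.
  exists (SigSub DX); have [Sg E] := gP (SigSub DX); exact: t_inj.
have SE : S = spread_of b (fun i (u : D) => t (g u) i).
  apply/seteqP; split=> X.
    case: (pselect (X = W_of U)) => [->|XW] SX; first by right.
    have [u gu] := gK X (conj SX XW).
    by left; exists u => //; rewrite -gu [RHS]gE.
  case=> [[u _ <-]|->//].
  by have := (gP u).1.1; rewrite {1}gE.
exists D, (fun i u => t (g u) i); split=> //; split=> [u u' uu'|c H hH].
  apply/(complementary_graphs hb); rewrite -!gE.
  apply: comp; [exact: (gP u).1.1 | exact: (gP u').1.1 | move=> E].
  by apply: uu'; apply: val_inj; rewrite -(gP u).2 -(gP u').2 E.
have [hL nWL] := hyperplane_lift (subspace_graph b c) (graph_complement hb c) hH.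
(* This X is not W, hence a graph, and lying in the lifted hyperplane it has
   values congruent to c modulo H. *)
have [X SX XL] := hyp _ hL.
have [u gu] : exists u, g u = X by apply: gK; split=> // XW; rewrite XW in XL.
have /choice[h hP] i : exists h, H h /\ t X i = c i + h.
  have := XL (t X i, b i); rewrite -gu => /(_ (tP _ (gP u).1 i)).
  move=> [[x1 x2] gx [_ [h Hh <-] [<- x2b]]]; exists h; split=> //.
  congr (_ + _); rewrite /= addr0 in x2b; rewrite x2b in gx.
  exact: (complement_inj (subspace_graph b c) (graph_complement hb c) gx
            (graph_basis b c i)).
by exists u, h; rewrite gu; split=> i; have [] := hP i.
Qed.

End Correspondence.

Theorem theorem5p5 (K : unitRingType) (hK : division_ring K)
    (U : lmodType K) (hU : exists u : U, u != 0)
    (I : eqType) (b : I -> U) (hb : is_basis b) :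
  (forall (D : set U) (tau : I -> D -> U),
     star_transversal tau -> dual_spread (spread_of b tau)) /\
  (forall S : set (set (U * U)%type), dual_spread S -> S (W_of U) ->
     exists (D : set U) (tau : I -> D -> U),
       star_transversal tau /\ S = spread_of b tau).
Proof.
split=> [D tau|S]; first exact: spread_of_dual_spread.
have [u u0] := hU; have [[|i s] [a [_ uE]]] := hb.2 u.
  by rewrite uE big_nil eqxx in u0.
exact: dual_spread_spread_of.
Qed.
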